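(* Let $m,n$ be positive integers and let $c,z,u_1,\dots,u_n,v_1,\dots,v_m$ be complex parameters in general position, with $z\ne1$ if $n>m$. Then $$F_{n,m}^{(z)}(\overline u|\overline v)=\prod_{1\le i<j\le m}\frac{1}{v_j-v_i}\det_{1\le i,j\le m}\Bigg(v_j^{i-1}-z(v_j-c)^{i-1}\prod_{\ell=1}^n\frac{v_j-u_\ell}{v_j-u_\ell-c}\Bigg)$$ and $$G_{n,m}^{(z)}(\overline u|\overline v)=(1-z)^{m-n}\prod_{1\le i<j\le n}\frac{1}{u_j-u_i}\det_{1\le i,j\le n}\Bigg(u_j^{i-1}-z(u_j+c)^{i-1}\prod_{\ell=1}^m\frac{u_j-v_\ell}{u_j-v_\ell+c}\Bigg).$$
   Context: Write $[1,\dots,n]=\{1,\dots,n\}$, $|K|$ for the cardinality of a set $K$, $\overline u=\{u_1,\dots,u_n\}$, $\overline v=\{v_1,\dots,v_m\}$; $j\notin K$ means $j$ lies in the complement of $K$ in the index set over which subsets are taken. The rational source functions are $$F_{n,m}^{(z)}(\overline u|\overline v)=\sum_{K\subset[1,\dots,m]}(-z)^{|K|}\prod_{i\in K,\,j\notin K}\frac{v_i-v_j-c}{v_i-v_j}\prod_{i\in K,\,1\le k\le n}\frac{v_i-u_k}{v_i-u_k-c},$$ $$G_{n,m}^{(z)}(\overline u|\overline v)=(1-z)^{m-n}\sum_{K\subset[1,\dots,n]}(-z)^{|K|}\prod_{i\in K,\,j\notin K}\frac{u_i-u_j+c}{u_i-u_j}\prod_{i\in K,\,1\le k\le m}\frac{u_i-v_k}{u_i-v_k+c}.$$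 ''In general position'' means that zeros of all factors in denominators are avoided. *)

(* Defs.v *)
From HB Require Import structures.
From mathcomp Require Import all_boot all_order all_algebra.
From mathcomp Require Import reals.
From mathcomp Require Import complex.

Set Implicit Arguments.
Unset Strict Implicit.
Unset Printing Implicit Defensive.

Import GRing.Theory.
Local Open Scope ring_scope.

(* The denominators are v_i - v_j, u_i - u_j (i <> j), v_i - u_k - c, and
   u_k - v_i + c; the last is the opposite of the previous one. *)
Definition general_position (F : fieldType) (n m : nat) (c : F)
    (u : 'I_n -> F) (v : 'I_m -> F) : Prop :=
  [/\ forall i j : 'I_n, i != j -> u i - u j != 0,
      forall i j : 'I_m, i != j -> v i - v j != 0
    & forall (i : 'I_m) (k : 'I_n), v i - u k - c != 0].

Definition sourceF (F : fieldType) (n m : nat) (c z : F)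
    (u : 'I_n -> F) (v : 'I_m -> F) : F :=
  \sum_(K : {set 'I_m})
    (- z) ^+ #|K|
    * (\prod_(i in K) \prod_(j | j \notin K) ((v i - v j - c) / (v i - v j)))
    * (\prod_(i in K) \prod_(k < n) ((v i - u k) / (v i - u k - c))).

(* The exponent m - n is an integer, possibly negative. *)
Definition sourceG (F : fieldType) (n m : nat) (c z : F)
    (u : 'I_n -> F) (v : 'I_m -> F) : F :=
  (1 - z) ^ (m%:Z - n%:Z)
  * \sum_(K : {set 'I_n})
      (- z) ^+ #|K|
      * (\prod_(i in K) \prod_(j | j \notin K) ((u i - u j + c) / (u i - u j)))
      * (\prod_(i in K) \prod_(k < m) ((u i - v k) / (u i - v k + c))).

(* Main.v *)
Require Import Defs.
From mathcomp Require Import all_boot all_order all_algebra.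
From mathcomp Require Import perm.
From mathcomp Require Import reals.
From mathcomp Require Import complex.

(** Both formulas are instances of one identity ([sum_subsets_Vandermonde]) for
    distinct nodes [x_j], a shift [c] and arbitrary weights [w_j]; the products
    coupling the two families of variables only enter through the weights.

    The column of index [j] of the determinant is the sum of the Vandermonde
    column at the node [x_j] and of [- z * w_j] times the Vandermonde column at
    the shifted node [x_j - c].  Expanding by multilinearity in the columns
    ([det_addC_expand]) gives a sum over the set [K] of columns from which the
    shifted term is taken.  Each term is [(- z) ^+ #|K|] times the weights over
    [K] times a Vandermonde determinant, in which the nodes of [K] are shifted.
    Divided by the unshifted Vandermonde determinant it becomes a product over
    pairs of nodes; pairs on the same side of [K] keep their difference and
    cancel, and the remaining pairs give the factors
    [(x_i - x_j - c) / (x_i - x_j)] of the source function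
    ([shifted_Vandermonde_ratio]).

    [sourceF] is the case of nodes [v] and shift [c], [sourceG] the case of nodes
    [u] and shift [- c]. *)

Set Implicit Arguments.
Unset Strict Implicit.
Unset Printing Implicit Defensive.

Import GRing.Theory.
Local Open Scope ring_scope.

Lemma det_addC_expand (R : comPzRingType) (n : nat) (A B : 'M[R]_n) :
  \det (A + B) =
    \sum_(K : {set 'I_n})
      \det (\matrix_(i, j) (if j \in K then A i j else B i j)).
Proof.
(* Transposing makes the product in the Leibniz formula run over columns. *)
rewrite -det_tr /determinant.
transitivity (\sum_(s : 'S_n) \sum_(K : {set 'I_n})
    (-1) ^+ s * \prod_j (if j \in K then A (s j) j else B (s j) j)).
  apply: eq_bigr => s _; rewrite -big_distrr /= -bigA_distr; congr (_ * _).
  by apply: eq_bigr => j _; rewrite !mxE.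
rewrite exchange_big; apply: eq_bigr => K _.
rewrite -[RHS]/(\det _) -[RHS]det_tr; apply: eq_bigr => s _; congr (_ * _).
by apply: eq_bigr => j _; rewrite !mxE.
Qed.

Lemma prod_lt_pairs (R : comPzRingType) (n : nat) (g : 'I_n -> 'I_n -> R) :
  \prod_(i < n) \prod_(j < n | (i < j)%N) (g i j * g j i) =
    \prod_(i < n) \prod_(j < n | j != i) g i j.
Proof.
under eq_bigr do rewrite big_split /=.
rewrite big_split /= [X in _ * X](exchange_big_dep predT) //= -big_split /=.
apply: eq_bigr => i _; rewrite [RHS](bigID (fun j : 'I_n => (i < j)%N)) /=.
by congr (_ * _); apply: eq_bigl => j; rewrite -val_eqE /=; case: ltngtP.
Qed.

(** A pair of nodes on the same side of [K] keeps its difference.  A pair with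
    exactly one node [x_i] in [K] contributes [(x_i - x_j - c) / (x_i - x_j)]
    whether [i < j] or [j < i], because the ratio of the differences does not
    change when the two nodes are exchanged. *)
Lemma shifted_Vandermonde_ratio (F : fieldType) (n : nat) (c : F)
    (x : 'I_n -> F) (K : {set 'I_n})
    (x_neq : forall i j : 'I_n, i != j -> x i - x j != 0) :
  let y j := if j \in K then x j - c else x j in
  \prod_(i < n) \prod_(j < n | (i < j)%N) ((y j - y i) / (x j - x i)) =
    \prod_(i in K) \prod_(j | j \notin K) ((x i - x j - c) / (x i - x j)).
Proof.
move=> y.
pose g i j := if (i \in K) && (j \notin K)
              then (x i - x j - c) / (x i - x j) else 1.
transitivity (\prod_(i < n) \prod_(j < n | (i < j)%N) (g i j * g j i)).
  apply: eq_bigr => i _; apply: eq_bigr => j lt_ij.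
  have ij : i != j by rewrite -val_eqE /= neq_ltn lt_ij.
  have xij := x_neq _ _ ij; rewrite eq_sym in ij; have xji := x_neq _ _ ij.
  rewrite /g /y; case: (i \in K); case: (j \in K); rewrite /= ?mulr1 ?mul1r.
  - by rewrite opprB addrA subrK divff.
  - by rewrite -[in LHS]opprB -[x j - x i]opprB invrN mulrNN addrAC.
  - by rewrite addrAC.
  - by rewrite divff.
rewrite prod_lt_pairs [RHS]big_mkcond; apply: eq_bigr => i _.
rewrite /g; case: ifPn => [iK | iK] /=; last by rewrite big1.
rewrite -big_mkcondr /=; apply: eq_bigl => j.
by case: eqVneq => [->|] //=; rewrite iK.
Qed.

Lemma sum_subsets_Vandermonde (F : fieldType) (n : nat) (c z : F)
    (x w : 'I_n -> F)
    (x_neq : forall i j : 'I_n, i != j -> x i - x j != 0) :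
  \sum_(K : {set 'I_n})
    (- z) ^+ #|K|
    * (\prod_(i in K) \prod_(j | j \notin K) ((x i - x j - c) / (x i - x j)))
    * (\prod_(i in K) w i) =
  (\prod_(i < n) \prod_(j < n | (i < j)%N) (1 / (x j - x i)))
  * \det (\matrix_(i < n, j < n) (x j ^+ i - z * (x j - c) ^+ i * w j)).
Proof.
pose A : 'M[F]_n := \matrix_(i, j) (- z * w j * (x j - c) ^+ i).
pose B : 'M[F]_n := \matrix_(i, j) x j ^+ i.
have -> : \matrix_(i < n, j < n) (x j ^+ i - z * (x j - c) ^+ i * w j) = A + B.
  by apply/matrixP=> i j; rewrite !mxE addrC mulrAC !mulNr.
rewrite det_addC_expand big_distrr; apply: eq_bigr => K _ /=.
pose y j := if j \in K then x j - c else x j.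
pose d := \row_j (if j \in K then - z * w j else 1).
have -> : \matrix_(i, j) (if j \in K then A i j else B i j) =
          Vandermonde n (\row_j y j) *m diag_mx d.
  apply/matrixP=> i j; rewrite mul_mx_diag !mxE /y.
  by case: (j \in K); rewrite ?mulr1 // mulrC.
rewrite det_mulmx.
have -> : \det (diag_mx d) = (- z) ^+ #|K| * \prod_(i in K) w i.
  rewrite det_diag -prodr_const -big_split [RHS]big_mkcond /=.
  by apply: eq_bigr => j _; rewrite mxE.
rewrite det_Vandermonde -shifted_Vandermonde_ratio // mulrA -big_split.
rewrite mulrCA mulrA; congr (_ * _ * _); apply: eq_bigr => i _ /=.
by rewrite -big_split; apply: eq_bigr => j _; rewrite /= !mxE mul1r mulrC.
Qed.

(* Indices in 'I_m start at 0, so the exponent i - 1 of the 1-based formula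
   is the ordinal i itself. *)
Theorem corollary4p2 (R : realType) (n m : nat) (hn : (0 < n)%N) (hm : (0 < m)%N)
    (c z : R[i]) (u : 'I_n -> R[i]) (v : 'I_m -> R[i])
    (hgen : general_position c u v) (hz : (m < n)%N -> z != 1) :
  sourceF c z u v =
    (\prod_(i < m) \prod_(j < m | (i < j)%N) (1 / (v j - v i)))
    * \det (\matrix_(i < m, j < m)
        (v j ^+ i
         - z * (v j - c) ^+ i * \prod_(l < n) ((v j - u l) / (v j - u l - c))))
  /\
  sourceG c z u v =
    (1 - z) ^ (m%:Z - n%:Z)
    * (\prod_(i < n) \prod_(j < n | (i < j)%N) (1 / (u j - u i)))
    * \det (\matrix_(i < n, j < n)
        (u j ^+ i
         - z * (u j + c) ^+ i * \prod_(l < m) ((u j - v l) / (u j - v l + c)))).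
Proof.
case: hgen => u_neq v_neq _; split; first exact: sum_subsets_Vandermonde.
have := @sum_subsets_Vandermonde _ _ (- c) z u
  (fun j => \prod_(l < m) ((u j - v l) / (u j - v l + c))) u_neq.
by rewrite /sourceG opprK => ->; rewrite mulrA.
Qed.
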